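(* Let $\rho$ be a rearrangement invariant function norm over a resonant $\sigma$-finite measure space $(\Omega,\Sigma,\mu)$. If for every $E\in\Sigma$ with $\mu(E)<\infty$ there is a constant $C_E$ with $\int_Ef\,d\mu\le C_E\rho(f)$ for all measurable $f\colon\Omega\to[0,\infty]$, then $\rho$ is leveling.
   Context: $L_0^+(\mu)$: measurable functions $\Omega\to[0,\infty]$ modulo a.e. equality. A function quasi-norm is $\rho\colon L_0^+(\mu)\to[0,\infty]$ with: $\rho(tf)=t\rho(f)$ ($t\ge0$); $f\le g$ a.e. $\Rightarrow\rho(f)\le\rho(g)$; $\rho(\chi_E)<\infty$ if $\mu(E)<\infty$; for every $E$ with $\mu(E)<\infty$ and $\varepsilon>0$ there is $\delta>0$ with $\mu(A)\le\varepsilon$ whenever $A\subseteq E$ measurable and $\rho(\chi_A)\le\delta$; and $\rho(f+g)\le\kappa(\rho(f)+\rho(g))$. A function norm is one with $\kappa=1$. $\rho$ is rearrangement invariant if every $f$ with $\rho(f)<\infty$ has finite distribution function ($\mu_f(s)=\mu\{f>s\}<\infty$ for all $s>0$) and $\rho(f)=\rho(g)$ whenever $\mu_f=\mu_g$. A measure space is resonant if it is either non-atomic or consists of atoms of equal measure. $\rho$ is leveling if there is $C$ with $\rho(\mathbb{E}(f,\Sigma_0))\le C\rho(f)$ for every finite sub-$\sigma$-algebra $\Sigma_0$ and $f\in L_0^+(\mu)$, where $\mathbb{E}(f,\Sigma_0)$ is the unique nonnegative $\Sigma_0$-measurable $g$ with $\int_Af\,d\mu=\int_Ag\,d\mu$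 for all $A\in\Sigma_0$.
   Formalization: On spaces of infinite measure the conditional expectation over a finite sub-σ-algebra may fail to exist or be unique; leveling is read as requiring the inequality, with one constant C, for exactly those f and Σ₀ for which E(f,Σ₀) exists and is unique a.e. *)

(* Defs.v *)
From HB Require Import structures.
From mathcomp Require Import all_boot all_order all_algebra.
From mathcomp Require Import all_classical all_reals all_analysis measurable_realfun.
Set Implicit Arguments. Unset Strict Implicit. Unset Printing Implicit Defensive.
Import Order.TTheory GRing.Theory Num.Theory.
Local Open Scope classical_set_scope.
Local Open Scope ring_scope.
Local Open Scope ereal_scope.

Section defs.
Context {d : measure_display} {T : measurableType d} {R : realType}.
Variable mu : {measure set T -> \bar R}.

(** Elements of L_0^+(mu): measurable functions into [0, +oo].
    (A function norm is a map on all functions; only its values on such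
    functions matter, and a.e.-monotonicity makes it constant on
    a.e.-equivalence classes.) *)
Definition L0p (f : T -> \bar R) : Prop :=
  measurable_fun setT f /\ forall x, 0 <= f x.

Definition indic (A : set T) : T -> \bar R := fun x => (\1_A x)%:E.

Definition function_norm (rho : (T -> \bar R) -> \bar R) : Prop :=
  [/\ (forall (t : R) f, (0 <= t)%R -> L0p f ->
          rho (fun x => t%:E * f x) = t%:E * rho f),
      (forall f g, L0p f -> L0p g -> {ae mu, forall x, f x <= g x} ->
          rho f <= rho g),
      (forall E, measurable E -> mu E < +oo -> rho (indic E) < +oo),
      (forall E, measurable E -> mu E < +oo -> forall eps : R, (0 < eps)%R ->
          exists2 delta : R, (0 < delta)%R &
          forall A, measurable A -> A `<=` E -> rho (indic A) <= delta%:E ->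
            mu A <= eps%:E) &
      (forall f g, L0p f -> L0p g -> rho (f \+ g) <= rho f + rho g)].

Definition distrib (f : T -> \bar R) (s : R) : \bar R := mu [set x | s%:E < f x].

Definition rearrangement_invariant (rho : (T -> \bar R) -> \bar R) : Prop :=
  (forall f, L0p f -> rho f < +oo -> forall s : R, (0 < s)%R -> distrib f s < +oo)
  /\ (forall f g, L0p f -> L0p g ->
        (forall s : R, (0 <= s)%R -> distrib f s = distrib g s) -> rho f = rho g).

Definition atom (A : set T) : Prop :=
  [/\ measurable A, 0 < mu A &
      forall B, measurable B -> B `<=` A -> mu B = 0 \/ mu (A `\` B) = 0].

Definition nonatomic : Prop := forall A, ~ atom A.

Definition equal_atomic : Prop :=
  exists2 c : R, (0 < c)%R &
  exists F : (set T)^nat, (forall n, atom (F n) /\ mu (F n) = c%:E) /\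
     mu (~` \bigcup_n F n) = 0.

Definition resonant : Prop := nonatomic \/ equal_atomic.

Definition finite_sub_sigma_algebra (S0 : set (set T)) : Prop :=
  [/\ sigma_algebra setT S0, S0 `<=` measurable & finite_set S0].

Definition S0_measurable (S0 : set (set T)) (g : T -> \bar R) : Prop :=
  forall B : set (\bar R), measurable B -> S0 (g @^-1` B).

Definition is_cond_exp (S0 : set (set T)) (f g : T -> \bar R) : Prop :=
  [/\ S0_measurable S0 g, (forall x, 0 <= g x) &
      forall A, S0 A -> \int[mu]_(x in A) f x = \int[mu]_(x in A) g x].

(** leveling: rho(E(f,S0)) <= C rho(f) whenever E(f,S0) is (well) defined,
    i.e. g is the (a.e.-)unique function with the defining properties *)
Definition leveling (rho : (T -> \bar R) -> \bar R) : Prop :=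
  exists C : R, forall S0 f g, finite_sub_sigma_algebra S0 -> L0p f ->
    is_cond_exp S0 f g ->
    (forall h, is_cond_exp S0 f h -> {ae mu, forall x, h x = g x}) ->
    rho g <= C%:E * rho f.

End defs.

(* Main.v *)
(** Both sides of the inequality [rho (E(f | S0)) <= rho f] are compared one
    level set of [g := E(f | S0)] at a time: [g] takes finitely many values, and
    on a level set [A] of positive value its value is the average of [f] over [A].
    Such an [A] has finite measure, for otherwise [g] could be modified on a
    minimal [S0]-set of infinite measure, against uniqueness.  So it suffices
    to show that replacing [f] on a set [A] of finite measure by its average over
    [A] does not increase [rho].

    There, approximate [f] from below, up to [eps] in the mean over [A], by a
    function that is constant on each of finitely many pieces of [A] of equal measure:
    the pieces are atoms in the atomic case, and come from Sierpinski's
    theorem in the nonatomic case.  The cyclic shifts of the values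
    over the pieces are equimeasurable, and their mean is constant on [A], so
    the triangle inequality applies; [eps] only costs [eps * rho(1_A)], so that no
    Fatou property is needed. *)
Require Import Defs.
From HB Require Import structures.
From mathcomp Require Import all_boot all_order all_algebra.
From mathcomp Require Import all_classical all_reals all_analysis measurable_realfun.
From mathcomp Require Import lra.
Set Implicit Arguments. Unset Strict Implicit. Unset Printing Implicit Defensive.
Import Order.TTheory GRing.Theory Num.Theory.
Local Open Scope classical_set_scope.
Local Open Scope ring_scope.
Local Open Scope ereal_scope.

(** * Sierpinski's theorem for nonatomic measures *)

Section measurable_subsets.
Context {d : measure_display} {T : measurableType d} {R : realType}.
Variable mu : {measure set T -> \bar R}.

Lemma measure_subD (A B : set T) : measurable A -> measurable B -> B `<=` A ->
  mu A = mu B + mu (A `\` B).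
Proof.
move=> mA mB BA; rewrite (measureDI mu mA mB) addeC.
by rewrite (_ : A `&` B = B)//; exact/setIidr.
Qed.

Lemma le_mu (A B : set T) : measurable A -> measurable B -> A `<=` B ->
  mu A <= mu B.
Proof. by move=> mA mB; apply: le_measure; rewrite inE. Qed.

Lemma fin_num_measure_lt (A : set T) : mu A < +oo -> mu A \is a fin_num.
Proof. by move=> h; rewrite ge0_fin_numE. Qed.

Hypothesis na : nonatomic mu.

(** As [A] is not an atom, it splits into two parts of nonzero measure; [B] is the smaller one. *)
Lemma nonatomic_half (A : set T) : measurable A -> 0 < mu A -> mu A < +oo ->
  exists B, [/\ measurable B, B `<=` A, 0 < mu B & mu B + mu B <= mu A].
Proof.
move=> mA A0 Aoo.
have [B [mB BA B0 AB0]] : exists B, [/\ measurable B, B `<=` A, mu B != 0 &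
    mu (A `\` B) != 0].
  apply: contrapT => h; have nA : ~ atom mu A := @na A; apply: nA; split => // B mB BA.
  have [?|b1] := eqVneq (mu B) 0; first by left.
  have [?|b2] := eqVneq (mu (A `\` B)) 0; first by right.
  by exfalso; apply: h; exists B.
have mAB : measurable (A `\` B) by exact: measurableD.
have e := measure_subD mA mB BA.
have [h|h] := leP (mu B) (mu (A `\` B)).
- exists B; split => //; first by rewrite lt0e B0/=.
  by rewrite e leeD2l.
- exists (A `\` B); split => //; first by rewrite lt0e AB0/=.
  by rewrite e leeD2r// ltW.
Qed.

(** Halving is iterated [n] times, where [n * eps] is at least [mu A]. The linear invariant
    [n * mu B <= mu A] stands in for the exponential one. *)
Lemma nonatomic_small (A : set T) (eps : R) : measurable A -> 0 < mu A -> mu A < +oo ->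
  (0 < eps)%R ->
  exists B, [/\ measurable B, B `<=` A, 0 < mu B & mu B <= eps%:E].
Proof.
move=> mA A0 Aoo e0.
have [n hn] : exists n : nat, (fine (mu A) <= n%:R * eps)%R.
  exists (Num.truncn (fine (mu A) / eps)).+1.
  by rewrite -ler_pdivrMr// ltW// truncnS_gt.
have : exists B, [/\ measurable B, B `<=` A, 0 < mu B & n%:R%:E * mu B <= mu A].
  elim: n {hn} => [|n [B [mB BA B0 h]]].
    by exists A; split => //; rewrite mul0e.
  have Boo : mu B < +oo by apply: le_lt_trans Aoo; apply: le_mu.
  have [C [mC CB C0 hC]] := nonatomic_half mB B0 Boo.
  exists C; split => //; first exact: subset_trans BA.
  (* For the factor 1 monotonicity suffices; from then on [n.+2 <= 2 * n.+1] turns one halving into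
     the next linear bound. *)
  case: n h => [|n] h; first by rewrite mul1e; apply: le_mu => //; exact: subset_trans BA.
  apply: le_trans h; apply: (@le_trans _ _ (n.+1%:R%:E * (mu C + mu C))).
    have Coo : mu C < +oo by apply: le_lt_trans Boo; apply: le_mu.
    rewrite -(fineK (fin_num_measure_lt Coo)) in C0 *.
    rewrite -EFinD -!EFinM lee_fin -mulr2n mulrnAr -mulrnAl ler_pM2r//.
    by rewrite -mulrnA ler_nat muln2 -addnn addnS ltnS leq_addr.
  by rewrite lee_pmul2l// lte_fin.
move=> [B [mB BA B0 h]]; exists B; split => //.
have Boo : mu B < +oo by apply: le_lt_trans Aoo; apply: le_mu.
rewrite -(fineK (fin_num_measure_lt Boo)) in B0 h *.
rewrite -(fineK (fin_num_measure_lt Aoo)) in A0 h.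
move: A0 B0 h; rewrite -EFinM !lte_fin !lee_fin => A0 B0 h.
case: n hn h => [|n] hn h; first by move: hn; rewrite mul0r leNgt A0.
by rewrite -(ler_pM2l (ltr0Sn R n)); apply: le_trans h _.
Qed.

(** A subset of [A] of measure at most [t] that is maximal up to null sets must have measure [t]:
    otherwise a small set of positive measure from the rest of [A] could still be added to it. *)
Lemma nonatomic_subset_measure (A : set T) (t : R) : measurable A -> mu A < +oo ->
  (0 <= t)%R -> t%:E <= mu A ->
  exists P, [/\ measurable P, P `<=` A & mu P = t%:E].
Proof.
move=> mA Aoo t0 tA.
pose good B := [/\ measurable B, B `<=` A & mu B <= t%:E].
(* Greedy construction of a set of measure at most [t] that is maximal up to null sets. *)
have step (nB : nat * set T) : exists C, good nB.2 ->
    [/\ good C, nB.2 `<=` C & forall D, good D -> nB.2 `<=` D ->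
      mu D <= mu C + (nB.1.+1%:R^-1)%:E].
  (* The value [set0] at sets that are not good is a dummy: [choice] asks for a total function. *)
  case: nB => n B /=; have [gB|nB] := pselect (good B); last by exists set0.
  pose S := [set mu D | D in [set D | good D /\ B `<=` D]].
  have SB : S (mu B) by exists B => //; split.
  have Sfin : ereal_sup S \is a fin_num.
    rewrite fin_numElt; apply/andP; split.
      by apply: lt_le_trans (ereal_sup_ubound SB); rewrite (lt_le_trans (ltNyr 0)).
    apply: (@le_lt_trans _ _ t%:E); last exact: ltry.
    by apply: ge_ereal_sup => _ [D [[_ _ Dt] _] <-].
  have e0 : (0 < n.+1%:R^-1 :> R)%R by rewrite invr_gt0.
  (* The measure of [C] comes within [1 / n.+1] of the supremum over all good sets containing
     [B]. *)
  have [_ [C [gC BC] <-] hC] := ub_ereal_sup_adherent e0 Sfin.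
  exists C => _; split => // D gD BD.
  rewrite -leeBlDr//; apply/ltW; apply: le_lt_trans hC.
  by rewrite leeB//; apply: ereal_sup_ubound; exists D.
have [f hf] := choice step.
pose C := fix C n := if n is m.+1 then f (m, C m) else set0.
have gC n : good (C n).
  elim: n => [|n gn]; first by split => //=; rewrite measure0 lee_fin.
  by have [] := hf (n, C n) gn.
have CS n : C n `<=` C n.+1 by have [] := hf (n, C n) (gC n).
have ndC : {homo C : n m / (n <= m)%N >-> (n <= m)%O}.
  by apply: homo_leq => //; [move=> x y z; exact: le_trans|move=> n; apply/subsetPset].
have mC n : measurable (C n) by have [] := gC n.
pose P := \bigcup_n C n.
have mP : measurable P by exact: bigcupT_measurable.
have CP n : C n `<=` P by exact: bigcup_sup.
have gP : good P.
  split => //; first by move=> x [n _]; have [_ + _] := gC n; exact.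
  have cvgP := nondecreasing_cvg_mu (mu := mu) mC mP ndC.
  rewrite -(cvg_lim _ cvgP)//; apply: lime_le; first by apply/cvg_ex; exists (mu P).
  by apply: nearW => n /=; have [] := gC n.
(* A good [D] containing [P] contains every [C n], so it competed at every stage and exceeds [mu P]
   by at most [1 / n.+1] for all [n]. *)
have maxP D : good D -> P `<=` D -> mu D <= mu P.
  move=> gD PD; apply/lee_addgt0Pr => e e0.
  have [n hn] : exists n : nat, (n.+1%:R^-1 < e)%R.
    exists (Num.truncn e^-1); rewrite -[ltRHS]invrK ltf_pV2 ?posrE ?invr_gt0//.
    exact: truncnS_gt.
  have [_ _ h] := hf (n, C n) (gC n).
  apply: (le_trans (h D gD (subset_trans (@CP n) PD))) => /=.
  by apply: leeD; [exact: (le_mu (mC n.+1) mP (CP n.+1))|rewrite lee_fin ltW].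
exists P; have [_ PA Pt] := gP; split => //.
apply/eqP; rewrite eq_le Pt/= leNgt; apply/negP => Plt.
have Poo : mu P < +oo by apply: le_lt_trans Pt _; exact: ltry.
have mAP : measurable (A `\` P) by exact: measurableD.
have AP0 : 0 < mu (A `\` P).
  rewrite measureD// (_ : A `&` P = P); last exact/setIidr.
  by rewrite sube_gt0 (lt_le_trans Plt).
have APoo : mu (A `\` P) < +oo by apply: le_lt_trans Aoo; exact: le_mu.
(* The room left below [t] bounds the measure of the set [B] to be added, so that [P] with [B] is
   still good. *)
have d0 : (0 < t - fine (mu P))%R.
  by rewrite subr_gt0 -lte_fin fineK// fin_num_measure_lt.
have [B [mB BAP B0 Bd]] := nonatomic_small mAP AP0 APoo d0.
have PB : [disjoint P & B] by apply/disj_set2P; rewrite -subset0 => x [Px /BAP[]].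
have PUB : mu (P `|` B) = mu P + mu B.
  by rewrite measureU//; exact/disj_set2P.
suff : mu (P `|` B) <= mu P.
  rewrite PUB -[leRHS]adde0 leeD2lE ?fin_num_measure_lt//.
  by rewrite leNgt B0.
apply: maxP; last exact: subsetUl.
split; [exact: measurableU|by rewrite subUset; split => // x /BAP[]|].
rewrite PUB (le_trans (leeD2l _ Bd))//.
rewrite -{1}(fineK (fin_num_measure_lt Poo)) -EFinD lee_fin; lra.
Qed.
End measurable_subsets.

(** * Cyclic shifts of values over pieces of equal measure *)

Section equal_pieces.
Context {d : measure_display} {T : measurableType d} {R : realType}.
Variable mu : {measure set T -> \bar R}.

Lemma bigsetU_ord n (P : 'I_n -> set T) :
  \big[setU/set0]_(k < n) P k = \bigcup_k P k.
Proof.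
rewrite -bigcup_seq; apply: eq_bigcupl; split => k //= _.
by rewrite mem_index_enum.
Qed.

Lemma sum_ord_const n (a : \bar R) : 0 <= a -> \sum_(j < n) a = n%:R%:E * a.
Proof.
move=> a0; elim: n => [|n IH]; first by rewrite big_ord0 mul0e.
by rewrite big_ord_recr/= IH -natr1 EFinD ge0_muleDl ?mul1e ?lee_fin.
Qed.

Definition put (A : set T) (a : \bar R) (f : T -> \bar R) : T -> \bar R :=
  fun x => if x \in A then a else f x.

Lemma putT A a f x : A x -> put A a f x = a.
Proof. by move=> Ax; rewrite /put mem_set. Qed.

Lemma putN A a f x : ~ A x -> put A a f x = f x.
Proof. by move=> Ax; rewrite /put memNset. Qed.

Lemma L0p_put (A : set T) (a : \bar R) (f : T -> \bar R) :
  measurable A -> 0 <= a -> L0p f -> L0p (put A a f).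
Proof.
move=> mA a0 [mf f0]; split; last by move=> x; rewrite /put; case: ifP.
apply: measurable_fun_ifT => //.
apply: (measurable_fun_bool true); rewrite setTI.
rewrite (_ : _ @^-1` _ = A)//; apply/seteqP; split => x /=.
  by move/set_mem.
by move/mem_set.
Qed.

Lemma measure_pieces n (P : 'I_n -> set T) (X : set T) :
  (forall k, measurable (P k)) -> trivIset setT P -> measurable X ->
  mu X = mu (X `\` \bigcup_k P k) + \sum_(k < n) mu (X `&` P k).
Proof.
move=> mP tP mX.
have mU : measurable (\bigcup_k P k) by exact: fin_bigcup_measurable.
rewrite (measureDI mu mX mU); congr (_ + _).
rewrite setI_bigcupr -bigsetU_ord measure_semi_additive_ord//.
- by move=> k; exact: measurableI.
- by apply: trivIset_setIl.
- by rewrite bigsetU_ord; apply: fin_bigcup_measurable => // k _; exact: measurableI.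
Qed.

(* Meant for pairwise disjoint [P k]. *)
Definition steps n (P : 'I_n -> set T) (c : 'I_n -> R) (f : T -> \bar R) : T -> \bar R :=
  fun x => if [pick k | x \in P k] is Some k then (c k)%:E else f x.

Section steps.
Variables (n : nat) (P : 'I_n -> set T).
Hypotheses (mP : forall k, measurable (P k)) (tP : trivIset setT P).

Lemma stepsT c f k x : P k x -> steps P c f x = (c k)%:E.
Proof.
move=> Pk; rewrite /steps; case: pickP => [j /set_mem Pj|/(_ k)]; last by rewrite mem_set.
by rewrite (tP I I (i := j) (j := k))//; exists x.
Qed.

Lemma stepsN c f x : ~ (\bigcup_k P k) x -> steps P c f x = f x.
Proof.
move=> Px; rewrite /steps; case: pickP => // j /set_mem Pj.
by exfalso; apply: Px; exists j.
Qed.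

Lemma L0p_steps c f : (forall k, (0 <= c k)%R) -> L0p f -> L0p (steps P c f).
Proof.
move=> c0 [mf f0]; split; last first.
  by move=> x; rewrite /steps; case: pickP => // k _; rewrite lee_fin.
move=> _ Y mY; rewrite setTI.
have mU : measurable (\bigcup_k P k) by exact: fin_bigcup_measurable.
rewrite (_ : _ @^-1` Y = (f @^-1` Y `\` \bigcup_k P k) `|`
    \bigcup_(k in [set k | Y (c k)%:E]) P k); last first.
  apply/seteqP; split => x /=.
    have [[k _ Pk]|Px] := pselect ((\bigcup_k P k) x).
      by rewrite (stepsT _ _ Pk) => Yk; right; exists k.
    by rewrite stepsN//; left.
  move=> [[fx Px]|[k /= Yk Pk]]; first by rewrite stepsN.
  by rewrite (stepsT _ _ Pk).
apply: measurableU; last exact: fin_bigcup_measurable.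
apply: measurableD => //.
by have := mf measurableT _ mY; rewrite setTI.
Qed.

(** The values [c] enter only through a symmetric sum over the pieces, so permuting them leaves the
    distribution function unchanged. *)
Lemma distrib_steps c f (delta : \bar R) (s : R) :
  (forall k, (0 <= c k)%R) -> L0p f -> (forall k, mu (P k) = delta) ->
  distrib mu (steps P c f) s = mu ([set x | s%:E < f x] `\` \bigcup_k P k) +
    \sum_(k < n) if (s < c k)%R then delta else 0.
Proof.
move=> c0 fL muP; rewrite /distrib (measure_pieces mP tP); last first.
  have [mF _] := L0p_steps c0 fL.
  have := emeasurable_fun_o_infty measurableT mF s%:E.
  by rewrite setTI.
congr (_ + _).
  congr (mu _); apply/seteqP; split => x /= [h Px]; split => //.
    by move: h; rewrite stepsN.
  by rewrite stepsN.
apply: eq_bigr => k _; case: ifPn => sc.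
  rewrite -(muP k); congr (mu _); apply/seteqP; split => x /=; first by case.
  by move=> Pk; split => //; rewrite (stepsT _ _ Pk) lte_fin.
rewrite -(measure0 mu); congr (mu _); apply/seteqP; split => x //= [+ Pk].
by rewrite (stepsT _ _ Pk) lte_fin (negbTE sc).
Qed.

End steps.

Variable rho : (T -> \bar R) -> \bar R.
Hypothesis fn : function_norm mu rho.

Lemma rho_le f g : L0p f -> L0p g -> (forall x, f x <= g x) -> rho f <= rho g.
Proof. by move=> Lf Lg fg; case: fn => _ + _ _ _; apply => //; exact: aeW. Qed.

Lemma L0p0 : L0p (fun _ : T => 0 : \bar R).
Proof. by split. Qed.

Lemma rho0 : rho (fun _ => 0) = 0.
Proof.
have [h _ _ _ _] := fn; have := h 0%R (fun _ => 0) (lexx _) L0p0.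
by rewrite (mul0e (rho _)) => h0; rewrite -[RHS]h0; congr rho; apply/funext => x; rewrite mul0e.
Qed.

Lemma rho_ge0 f : L0p f -> 0 <= rho f.
Proof. by move=> Lf; rewrite -rho0 rho_le//; exact: Lf.2. Qed.

Lemma rho_sum n (F : 'I_n -> T -> \bar R) : (forall j, L0p (F j)) ->
  rho (fun x => \sum_(j < n) F j x) <= \sum_(j < n) rho (F j).
Proof.
elim: n F => [|n IH] F LF.
  by rewrite big_ord0; under eq_fun do rewrite big_ord0; rewrite rho0.
rewrite big_ord_recr/=.
rewrite (_ : (fun _ => _) = ((fun x => \sum_(j < n) F (widen_ord (leqnSn n) j) x) \+ F ord_max)).
  have [_ _ _ _ h] := fn; apply: (le_trans (h _ _ _ _)) => //.
    split; first by apply: emeasurable_sum => j; have [] := LF (widen_ord (leqnSn n) j).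
    by move=> x; apply: sume_ge0 => j _; have [] := LF (widen_ord (leqnSn n) j).
  by rewrite leeD2r// IH.
by apply/funext => x; rewrite big_ord_recr.
Qed.

Hypothesis ri : rearrangement_invariant mu rho.

(** The shifts [F j] are equimeasurable with [F ord0], which lies below [f]. Their mean is the
    function on the left, so homogeneity and the triangle inequality give the bound. *)
Lemma rho_equal_pieces n (P : 'I_n.+1 -> set T) (c : 'I_n.+1 -> R) (delta : \bar R)
    (f : T -> \bar R) :
  (forall k, measurable (P k)) -> trivIset setT P -> (forall k, mu (P k) = delta) ->
  (forall k, (0 <= c k)%R) -> L0p f -> (forall k x, P k x -> (c k)%:E <= f x) ->
  rho (put (\bigcup_k P k) (n.+1%:R^-1 * \sum_(k < n.+1) c k)%R%:E f) <= rho f.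
Proof.
move=> mP tP muP c0 Lf cf.
have mU : measurable (\bigcup_k P k) by exact: fin_bigcup_measurable.
(* The sum [k + j] is taken modulo [n.+1]; the successor in the index type provides this group
   structure. *)
pose F (j : 'I_n.+1) := steps P (fun k => c (k + j)%R) f.
have LF j : L0p (F j) by exact: L0p_steps.
have rhoF j : rho (F j) <= rho f.
  have -> : rho (F j) = rho (F ord0).
    apply: ri.2 => // s s0; rewrite !(distrib_steps mP tP (delta := delta))//.
    congr (_ + _); rewrite (reindex_inj (addIr (- j)%R))/=; apply: eq_bigr => k _.
    by rewrite subrK addr0.
  apply: rho_le => // x; have [[k _ Pk]|Px] := pselect ((\bigcup_k P k) x).
    by rewrite /F (stepsT tP _ _ Pk) addr0; exact: cf.
  by rewrite /F stepsN.
have Ln : L0p (fun x => \sum_(j < n.+1) F j x).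
  split; first by apply: emeasurable_sum => j; have [] := LF j.
  by move=> x; apply: sume_ge0 => j _; have [] := LF j.
have n0 : (0 <= n.+1%:R^-1 :> R)%R by rewrite invr_ge0.
(* On the piece [P k] the indices [k + j] run through all of ['I_n.+1]; off the pieces every [F j]
   equals [f]. *)
have -> : put (\bigcup_k P k) (n.+1%:R^-1 * \sum_(k < n.+1) c k)%R%:E f =
    (fun x => (n.+1%:R^-1)%:E * \sum_(j < n.+1) F j x).
  apply/funext => x; have [[k _ Pk]|Px] := pselect ((\bigcup_k P k) x).
    rewrite putT; last by exists k.
    rewrite EFinM; congr (_ * _); rewrite (reindex_inj (addrI k))/= -sumEFin.
    by apply: eq_bigr => j _; rewrite /F (stepsT tP _ _ Pk).
  rewrite putN//.
  under eq_bigr do rewrite /F stepsN//.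
  by rewrite sum_ord_const ?Lf.2// muleA -EFinM mulVf// mul1e.
have [h _ _ _ _] := fn; rewrite h//.
apply: (@le_trans _ _ ((n.+1%:R^-1)%:E * \sum_(j < n.+1) rho f)).
  apply: lee_wpmul2l; first by rewrite lee_fin.
  by apply: (le_trans (rho_sum LF)); exact: lee_sum.
by rewrite sum_ord_const ?rho_ge0// muleA -EFinM mulVf// mul1e//.
Qed.

End equal_pieces.

(** * Cutting a set greedily into pieces of equal measure *)

Section pieces.
Context {d : measure_display} {T : measurableType d} {R : realType}.
Variable mu : {measure set T -> \bar R}.

Lemma ge0_integral_subD (A B : set T) (f : T -> \bar R) :
  measurable A -> measurable B -> B `<=` A -> L0p f ->
  \int[mu]_(x in A) f x = \int[mu]_(x in B) f x + \int[mu]_(x in A `\` B) f x.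
Proof.
move=> mA mB BA [mf f0]; rewrite -{1}(setDUK BA) ge0_integral_setU//.
- exact: measurableD.
- exact: measurable_funTS.
- by apply/disj_set2P; rewrite -subset0 => x [Bx []].
Qed.

Lemma ge0_integral_le_cst (A : set T) (f : T -> \bar R) (M : R) :
  measurable A -> L0p f -> (forall x, A x -> f x <= M%:E) ->
  \int[mu]_(x in A) f x <= M%:E * mu A.
Proof.
move=> mA [mf f0] fM; rewrite -integral_cst//.
by apply: ge0_le_integral => //; exact: measurable_funTS.
Qed.

(* The hypothesis on [B] lets pieces be cut off greedily: on a piece where [f] is
   not constant the mass is wasted, but this only happens once what is
   left has measure at most [kappa]. *)
Lemma split_pieces (f : T -> \bar R) (M delta kappa : R) :
  (0 < delta)%R -> (0 <= M)%R -> (0 <= kappa)%R ->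
  L0p f -> (forall x, f x <= M%:E) ->
  (forall B, measurable B -> mu B < +oo -> delta%:E <= mu B ->
    exists P, exists2 a : R, [/\ measurable P, P `<=` B, mu P = delta%:E, (0 <= a)%R &
         forall x, P x -> a%:E <= f x]
      & (forall x, P x -> f x = a%:E) \/ mu B <= kappa%:E) ->
  forall N A, measurable A -> mu A = (N%:R * delta)%:E ->
  exists (P : nat -> set T) (c : nat -> R),
    [/\ forall k, (k < N)%N -> [/\ measurable (P k), P k `<=` A, mu (P k) = delta%:E,
         (0 <= c k)%R & forall x, P k x -> (c k)%:E <= f x],
        trivIset `I_N P &
        \int[mu]_(x in A) f x <= ((\sum_(k < N) c k) * delta + M * kappa)%:E].
Proof.
move=> d0 M0 k0 Lf fM hB; have [mf f0] := Lf; elim=> [|N IH] A mA muA.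
  exists (fun _ => set0), (fun _ => 0%R); split => //.
  rewrite null_set_integral//; last by rewrite muA mul0r.
    by rewrite big_ord0 mul0r add0r lee_fin mulr_ge0.
  exact: measurable_funTS.
have Aoo : mu A < +oo by rewrite muA ltry.
have [P [a [mP PA muP a0 aP] Pa]] : exists P, exists2 a : R,
    [/\ measurable P, P `<=` A, mu P = delta%:E, (0 <= a)%R &
         forall x, P x -> a%:E <= f x]
      & (forall x, P x -> f x = a%:E) \/ mu A <= kappa%:E.
  by apply: hB => //; rewrite muA lee_fin ler_peMl ?ler1n// ltW.
have mAP : measurable (A `\` P) by exact: measurableD.
have muAP : mu (A `\` P) = (N%:R * delta)%:E.
  have APoo : mu (A `\` P) < +oo by apply: le_lt_trans Aoo; exact: le_mu.
  have := measure_subD mu mA mP PA; rewrite muA muP.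
  rewrite -(fineK (fin_num_measure_lt APoo)) -EFinD -natr1 mulrDl mul1r => -[e].
  by congr (_%:E); lra.
have [Q [c [hQ tQ intQ]]] := IH _ mAP muAP.
exists (fun k => if k == N then P else Q k), (fun k => if k == N then a else c k).
have ltN k : (k < N)%N -> (k == N) = false by move=> kN; rewrite ltn_eqF.
split.
- move=> k; rewrite ltnS leq_eqVlt => /predU1P[->|kN]; first by rewrite eqxx.
  have [? QA ? ? ?] := hQ _ kN; rewrite ltN//; split => //.
  by move=> x /QA[].
- move=> i j /=; rewrite !ltnS (leq_eqVlt i) (leq_eqVlt j) => /predU1P[->|iN] /predU1P[->|jN] //.
  + rewrite eqxx ltN// => -[x [Px Qx]]; have [_ QA _ _ _] := hQ _ jN.
    by have [] := QA _ Qx.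
  + rewrite eqxx ltN// => -[x [Qx Px]]; have [_ QA _ _ _] := hQ _ iN.
    by have [] := QA _ Qx.
  + by rewrite !ltN//; exact: tQ.
- rewrite big_ord_recr/= eqxx (eq_bigr (fun k : 'I_N => c k)); last first.
    by move=> k _; rewrite ltN.
  have c0 : (0 <= \sum_(k < N) c k)%R.
    by apply: sumr_ge0 => k _; have [] := hQ k (ltn_ord k).
  (* If [f] is constant on [P], the piece contributes exactly [a * delta] and the error is inherited
     from the rest. Otherwise the whole integral over [A] is at most [M * kappa], and the
     nonnegative sum is dropped; hence the error never accumulates. *)
  case: Pa => [Pa|Ak].
    rewrite (ge0_integral_subD mA mP PA Lf).
    rewrite (_ : \int[mu]_(x in P) f x = (a * delta)%:E); last first.
      rewrite (eq_integral (cst a%:E)); last by move=> x /set_mem /Pa.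
      by rewrite integral_cst// muP.
    rewrite (le_trans (leeD2l _ intQ))// -EFinD lee_fin; lra.
  apply: (le_trans (ge0_integral_le_cst mA Lf (fun x _ => fM x))).
  apply: (@le_trans _ _ (M%:E * kappa%:E)); first by rewrite lee_wpmul2l.
  by rewrite -EFinM lee_fin lerDr mulr_ge0 ?addr_ge0// ltW.
Qed.

Section level_sets.
Variables (h : T -> R) (s : seq R).
Hypotheses (mh : measurable_fun setT h) (hs : forall x, h x \in s).

Lemma measurable_level v : measurable (h @^-1` [set v]).
Proof. by rewrite -[_ @^-1` _]setTI; exact: mh. Qed.

(** Finite subadditivity over the level sets. Read contrapositively, a set of large measure meets
    some level set of [h] in a large part; [delta = 0] gives a level set of positive measure. *)
Lemma measure_le_level_sets (B : set T) (delta : R) : measurable B -> (0 <= delta)%R ->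
  (forall v, v \in s -> mu (B `&` h @^-1` [set v]) <= delta%:E) ->
  mu B <= ((size s)%:R * delta)%:E.
Proof.
move=> mB d0 hv.
have BE : B = B `&` [set x | h x \in s] by apply/esym/setIidl => x _; exact: hs.
have nilE : B `&` [set x | h x \in [::]] = set0.
  by apply/seteqP; split => x //= [].
have consE v r : B `&` [set x | h x \in v :: r] =
    (B `&` h @^-1` [set v]) `|` (B `&` [set x | h x \in r]).
  apply/seteqP; split => x /=; rewrite inE.
    by move=> [Bx /orP[/eqP|]]; [left|right].
  by move=> [[Bx ->]|[Bx ->]]; rewrite ?eqxx ?orbT.
have mB1 v : measurable (B `&` h @^-1` [set v]).
  by apply: measurableI => //; exact: measurable_level.
have ms (r : seq R) : measurable (B `&` [set x | h x \in r]).
  by elim: r => [|w r IHr]; rewrite ?nilE// consE; exact: measurableU.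
rewrite BE; elim: (s) hv => [|v r IH] hr; first by rewrite nilE measure0 mul0r.
rewrite consE; apply: (le_trans (measureU2 _ _ _)) => //.
rewrite /= -natr1 mulrDl mul1r EFinD addeC leeD//.
  by apply: hr; rewrite inE eqxx.
by apply: IH => w wr; apply: hr; rewrite inE wr orbT.
Qed.
End level_sets.
End pieces.

(** * Pieces in a space of atoms of equal measure *)

Section atomic.
Context {d : measure_display} {T : measurableType d} {R : realType}.
Variable mu : {measure set T -> \bar R}.
Variables (c : R) (F : (set T)^nat).
Hypotheses (c0 : (0 < c)%R) (atF : forall n, atom mu (F n) /\ mu (F n) = c%:E).
Hypothesis coverF : mu (~` \bigcup_n F n) = 0.

(** Some atom meets [B], and then some level set of [h], in positive measure. A subset of positive
    measure of an atom has its full measure [c]. *)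
Lemma atomic_piece (h : T -> R) (s : seq R) (B : set T) :
  measurable_fun setT h -> (forall x, h x \in s) ->
  measurable B -> 0 < mu B ->
  exists P v, [/\ measurable P, P `<=` B, mu P = c%:E & forall x, P x -> h x = v].
Proof.
move=> mh hs mB B0.
have mF n : measurable (F n) by have [[]] := atF n.
have mBF n : measurable (B `&` F n) by exact: measurableI.
have [n Bn] : exists n, 0 < mu (B `&` F n).
  apply: contrapT => /forallNP hn; move: B0; rewrite lt0e => /andP[/eqP + _]; apply.
  apply/negligibleP => //.
  rewrite (_ : B = (B `\` \bigcup_n F n) `|` \bigcup_n (B `&` F n)); last first.
    by rewrite -setI_bigcupr setUC setUIDK.
  apply: negligibleU.
    apply: (@negligibleS _ _ _ _ (~` \bigcup_n F n)); first by move=> x [].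
    by apply/negligibleP => //; apply: measurableC; exact: bigcupT_measurable.
  apply: negligible_bigcup => k; apply/negligibleP => //.
  by apply/eqP; rewrite eq_le measure_ge0 andbT leNgt; apply/negP; exact: hn.
have [v Bv] : exists v, 0 < mu (B `&` F n `&` h @^-1` [set v]).
  apply: contrapT => /forallNP hv; move: Bn; apply/negP; rewrite -leNgt.
  have := @measure_le_level_sets _ _ _ mu h s mh hs (B `&` F n) 0%R (mBF n) (lexx _).
  rewrite mulr0; apply => w _; rewrite leNgt; apply/negP; exact: hv.
have mP : measurable (B `&` F n `&` h @^-1` [set v]).
  by apply: measurableI => //; exact: measurable_level.
exists (B `&` F n `&` h @^-1` [set v]), v; split => //.
- by move=> x [[]].
- have [[_ _ atFn] muFn] := atF n.
  have PF : B `&` F n `&` h @^-1` [set v] `<=` F n by move=> x [[]].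
  case: (atFn _ mP PF) => e; first by rewrite e ltxx in Bv.
  by have := measure_subD mu (mF n) mP PF; rewrite e adde0 muFn.
- by move=> x [].
Qed.

(** Pieces of measure [c] are removed until a null set is left; the induction is on an upper bound
    [N] for [mu A / c]. *)
Lemma atomic_measure (A : set T) : measurable A -> mu A < +oo ->
  exists N : nat, mu A = (N%:R * c)%:E.
Proof.
move=> mA Aoo.
have [N] : exists N : nat, mu A <= (N%:R * c)%:E.
  exists (Num.truncn (fine (mu A) / c)).+1.
  rewrite -(fineK (fin_num_measure_lt Aoo)) lee_fin -ler_pdivrMr//.
  by rewrite ltW// truncnS_gt.
elim: N A mA Aoo => [|N IH] A mA Aoo AN.
  by exists 0%N; apply/eqP; rewrite eq_le AN/= mul0r.
have [A0|A0] := eqVneq (mu A) 0; first by exists 0%N; rewrite A0 mul0r.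
(* The function is taken to be constantly 0, because only the measure of the piece matters here. *)
have [P [v [mP PA muP _]]] : exists P v, [/\ measurable P, P `<=` A, mu P = c%:E &
    forall x, P x -> (fun=> 0%R : R) x = v].
  by apply: (@atomic_piece _ [:: 0%R]) => //; [move=> x; rewrite inE|rewrite lt0e A0/=].
have mAP : measurable (A `\` P) by exact: measurableD.
have APoo : mu (A `\` P) < +oo by apply: le_lt_trans Aoo; exact: le_mu.
have e := measure_subD mu mA mP PA.
have [|k hk] := IH _ mAP APoo.
  move: AN; rewrite e muP -(fineK (fin_num_measure_lt APoo)) -EFinD !lee_fin.
  rewrite -natr1 mulrDl; lra.
by exists k.+1; rewrite e hk muP -EFinD -natr1 mulrDl mul1r addrC.
Qed.

End atomic.

(** * Equal pieces for simple functions on a resonant space *)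

Section pieces.
Context {d : measure_display} {T : measurableType d} {R : realType}.
Variable mu : {measure set T -> \bar R}.

(** Both kinds of resonant space satisfy the cutting hypothesis of [split_pieces]. With atoms,
    [delta] is their measure and [h] is constant on every piece; without, [delta] is a fraction of
    [mu A] so small that pieces with nonconstant [h] occur only within measure [kappa]. *)
Lemma resonant_pieces (A : set T) (h : T -> R) (s : seq R) (eps : R) :
  resonant mu -> measurable A -> 0 < mu A -> mu A < +oo ->
  measurable_fun setT h -> (forall x, (0 <= h x)%R) -> (forall x, h x \in s) ->
  (0 < eps)%R ->
  exists (n : nat) (delta : R) (P : nat -> set T) (c : nat -> R),
   [/\ (forall k, (k < n.+1)%N -> [/\ measurable (P k), P k `<=` A, mu (P k) = delta%:E,
         (0 <= c k)%R & forall x, P k x -> (c k <= h x)%R]),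
        trivIset `I_n.+1 P, (0 < delta)%R, mu A = (n.+1%:R * delta)%:E &
        \int[mu]_(x in A) (h x)%:E <= ((\sum_(k < n.+1) c k) * delta + eps)%:E].
Proof.
move=> res mA A0 Aoo mh h0 hs eps0.
pose f : T -> \bar R := EFin \o h.
have Lf : L0p f by split => //; exact/measurable_EFinP.
pose M := (\sum_(v <- s) `|v|)%R.
have M0 : (0 <= M)%R by exact: sumr_ge0.
have fM x : f x <= M%:E.
  rewrite lee_fin /M (big_rem (h x))//= (le_trans (ler_norm _))// lerDl.
  exact: sumr_ge0.
(* The added 1 in [eps / (M + 1)] covers the case [M = 0]. *)
have [kappa [k0 Mk]] : exists kappa : R, (0 < kappa)%R /\ (M * kappa <= eps)%R.
  exists (eps / (M + 1))%R; have M1 : (0 < M + 1)%R by rewrite ltr_wpDl.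
  rewrite divr_gt0//; split => //; rewrite mulrCA -[leRHS]mulr1 ler_pM2l//.
  by rewrite ler_pdivrMr// mul1r lerDl.
suff [n [delta [d0 muA hB]]] : exists (n : nat) (delta : R), [/\ (0 < delta)%R,
    mu A = (n.+1%:R * delta)%:E &
    (forall B, measurable B -> mu B < +oo -> delta%:E <= mu B ->
    exists P, exists2 a : R, [/\ measurable P, P `<=` B, mu P = delta%:E, (0 <= a)%R &
         forall x, P x -> a%:E <= f x]
      & (forall x, P x -> f x = a%:E) \/ mu B <= kappa%:E)].
  have [P [c [hP tP intP]]] := split_pieces d0 M0 (ltW k0) Lf fM hB mA muA.
  exists n, delta, P, c; split => //.
  by rewrite (le_trans intP)// lee_fin lerD2l.
case: res => [na|[c c0 [F [atF coverF]]]].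
  pose m := fine (mu A).
  have Am : mu A = m%:E by rewrite fineK// fin_num_measure_lt.
  have m0 : (0 < m)%R by rewrite -lte_fin -Am.
  (* This choice makes [size s] times [m / n.+1] at most [kappa]. *)
  pose n := Num.truncn ((size s)%:R * m / kappa).
  have n1 : (0 < n.+1%:R :> R)%R by [].
  exists n, (m / n.+1%:R)%R; have d0 : (0 < m / n.+1%:R)%R by rewrite divr_gt0.
  split => //; first by rewrite Am mulrCA divff// mulr1.
  move=> B mB Boo dB.
  have [[v dv]|hv] := pselect (exists v, (m / n.+1%:R)%:E <= mu (B `&` h @^-1` [set v])).
    have mBv : measurable (B `&` h @^-1` [set v]).
      by apply: measurableI => //; exact: measurable_level.
    have Bvoo : mu (B `&` h @^-1` [set v]) < +oo.
      by apply: le_lt_trans Boo; apply: le_mu => // x [].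
    have [P [mP PB muP]] := nonatomic_subset_measure na mBv Bvoo (ltW d0) dv.
    (* A point of [P] is needed to see that the value [v] is nonnegative. *)
    have [x Px] : P !=set0.
      apply/set0P/eqP => P0; move: muP; rewrite P0 measure0 => -[e].
      by rewrite -e ltxx in d0.
    exists P, v; last by left => y /PB[_ /= <-].
    split => //; first by move=> y /PB[].
      by have [_ /= <-] := PB x Px.
    by move=> y /PB[_ /= <-].
  (* No level set can hold a piece, so an arbitrary piece is cut off with value 0, and [mu B] is at
     most [size s] times the measure of a piece. *)
  have [P [mP PB muP]] := nonatomic_subset_measure na mB Boo (ltW d0) dB.
  exists P, 0%R; first by split => // x _; rewrite lee_fin.
  right; apply: (le_trans (measure_le_level_sets mh hs mB (ltW d0) _)).
    move=> v _; rewrite leNgt; apply/negP => /ltW dv; apply: hv; by exists v.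
  rewrite lee_fin mulrA ler_pdivrMr// [leRHS]mulrC -ler_pdivrMr//.
  exact: ltW (truncnS_gt _).
have [[|n] muA] := atomic_measure c0 atF coverF mA Aoo.
  by move: A0; rewrite muA mul0r ltxx.
exists n, c; split => // B mB Boo cB.
have B0 : 0 < mu B by rewrite (lt_le_trans _ cB)// lte_fin.
have [P [v [mP PB muP hP]]] := atomic_piece atF coverF mh hs mB B0.
have [x Px] : P !=set0.
  apply/set0P/eqP => P0; move: muP; rewrite P0 measure0 => -[e].
  by rewrite -e ltxx in c0.
exists P, v; last by left => y /hP /= <-.
split => //; first by rewrite -(hP x Px).
by move=> y /hP /= <-.
Qed.
End pieces.

(** * Averaging over one set of finite measure *)

Section averaging.
Import HBNNSimple.
Context {d : measure_display} {T : measurableType d} {R : realType}.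
Variable mu : {measure set T -> \bar R}.

Lemma simple_below (A : set T) (f : T -> \bar R) (eps : R) :
  measurable A -> L0p f -> \int[mu]_(x in A) f x < +oo -> (0 < eps)%R ->
  exists (h : T -> R) (s : seq R), [/\ measurable_fun setT h, (forall x, (0 <= h x)%R),
    (forall x, h x \in s), (forall x, (h x)%:E <= f x) &
    \int[mu]_(x in A) f x <= \int[mu]_(x in A) (h x)%:E + eps%:E].
Proof.
move=> mA [mf f0] foo eps0.
have fA0 x : 0 <= (f \_ A) x by apply: erestrict_ge0 => ? _; exact: f0.
have ffin : \int[mu]_(x in A) f x \is a fin_num.
  by rewrite ge0_fin_numE// integral_ge0.
move: (ffin); rewrite integral_mkcond ge0_integralTE// => supfin.
have [_ [h /= hf <-] hsup] := ub_ereal_sup_adherent eps0 supfin.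
have [s hs] := (finite_seqP (range h)).1 (fimfunP h).
exists h, s; split => //.
- by move=> x; have : range h (h x) by []; rewrite hs.
- move=> x; apply: (le_trans (hf x)); rewrite /patch; case: ifP => // _; exact: f0.
- rewrite -leeBlDr// (le_trans (ltW hsup))// -integralT_nnsfun [leRHS]integral_mkcond.
  (* As [h] lies between 0 and [f \_ A], it vanishes off [A], so its integrals over [A] and over the
     whole space agree. *)
  rewrite le_eqVlt; apply/orP; left; apply/eqP; apply: eq_integral => x _.
  rewrite /patch; case: ifPn => // xA; apply/eqP; rewrite eq_le !lee_fin fun_ge0 andbT -lee_fin.
  by have := hf x; rewrite /patch (negbTE xA).
Qed.

Variable rho : (T -> \bar R) -> \bar R.
Hypotheses (res : resonant mu) (fn : function_norm mu rho).
Hypothesis ri : rearrangement_invariant mu rho.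

(** If [b] is the mean of the values on the pieces, then [a <= b + eps], so the averaged function is
    at most [put A b f] plus [eps] times the indicator of [A]. The norm of that indicator is finite,
    and [eps] tends to 0. *)
Lemma rho_put_avg (A : set T) (f : T -> \bar R) (a : R) :
  measurable A -> 0 < mu A -> mu A < +oo -> L0p f -> (0 <= a)%R ->
  \int[mu]_(x in A) f x = a%:E * mu A ->
  rho (put A a%:E f) <= rho f.
Proof.
move=> mA A0 Aoo Lf a0 intf.
have Am := fineK (fin_num_measure_lt Aoo); set m := fine (mu A) in Am.
have m0 : (0 < m)%R by rewrite -lte_fin Am.
have foo : \int[mu]_(x in A) f x < +oo by rewrite intf -Am -EFinM ltry.
have LA : L0p (Defs.indic A : T -> \bar R).
  by split; [exact/measurable_EFinP|move=> x; rewrite /Defs.indic lee_fin].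
have step (eps : R) : (0 < eps)%R ->
    rho (put A a%:E f) <= rho f + eps%:E * rho (Defs.indic A).
  (* The error [eps * m / 2] is spent twice, on the simple function and on the pieces; dividing by
     [m] leaves [eps]. *)
  move=> eps0; have e0 : (0 < eps * m / 2)%R by rewrite divr_gt0// mulr_gt0.
  have [h [s [mh h0 hs hf inth]]] := simple_below mA Lf foo e0.
  have [n [delta [P [c [hP tP d0 muA intP]]]]] :=
    resonant_pieces res mA A0 Aoo mh h0 hs e0.
  have {}hP (k : 'I_n.+1) := hP k (ltn_ord k).
  pose Q (k : 'I_n.+1) := P k.
  have mQ k : measurable (Q k) by have [] := hP k.
  have tQ : trivIset setT Q.
    by move=> i j _ _ PP; apply: val_inj; exact: (tP i j (ltn_ord i) (ltn_ord j) PP).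
  have muQ k : mu (Q k) = delta%:E by have [] := hP k.
  have mU : measurable (\bigcup_k Q k) by exact: fin_bigcup_measurable.
  pose b := (n.+1%:R^-1 * \sum_(k < n.+1) c k)%R.
  have b0 : (0 <= b)%R.
    by rewrite mulr_ge0 ?invr_ge0// sumr_ge0// => k _; have [] := hP k.
  have ab : (a <= b + eps)%R.
    have : a%:E * mu A <= ((\sum_(k < n.+1) c k) * delta + eps * m / 2 + eps * m / 2)%:E.
      by rewrite -intf (le_trans inth)// EFinD leeD2r.
    have mE : m = (n.+1%:R * delta)%R by move: muA; rewrite -Am => -[].
    rewrite -Am -EFinM lee_fin -addrA -splitr.
    have -> : ((\sum_(k < n.+1) c k) * delta = b * m)%R.
      by rewrite mE /b mulrACA mulVf// mul1r.
    by rewrite -mulrDl ler_pM2r.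
  have Lb : L0p (put A b%:E f) by exact: L0p_put.
  apply: (@le_trans _ _ (rho (put A b%:E f) + rho (fun x => eps%:E * Defs.indic A x))).
    have LeA : L0p (fun x => eps%:E * Defs.indic A x).
      split; last by move=> x; rewrite mule_ge0 ?lee_fin ?LA.2// ltW.
      by apply: measurable_funeM; exact: LA.1.
    have [_ _ _ _ tri] := fn; apply: le_trans (tri _ _ Lb LeA).
    apply: (rho_le fn).
    - exact: L0p_put.
    - split; first by apply: emeasurable_funD; [exact: Lb.1|exact: LeA.1].
      by move=> x; rewrite adde_ge0// ?Lb.2// LeA.2.
    - move=> x /=; rewrite /Defs.indic indicE /put; case: ifP => _ /=.
        by rewrite -EFinM -EFinD lee_fin mulr1.
      by rewrite mule0 adde0.
  have [homog _ _ _ _] := fn; rewrite homog//; last exact: ltW.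
  rewrite leeD2r//; apply: le_trans
    (rho_equal_pieces fn ri (c := fun k => c k) mQ tQ muQ _ Lf _).
  - have [_ mono _ _ _] := fn; apply: mono => //; first exact: L0p_put.
    (* The measures of the pieces add up to [mu A], so averaging over their union or over [A]
       differs only on a null set. *)
    have N0 : mu (A `\` \bigcup_k Q k) = 0.
      have := measure_pieces mu mQ tQ mA.
      rewrite (eq_bigr (fun=> delta%:E)); last first.
        move=> k _; rewrite (_ : _ `&` _ = Q k); first by have [] := hP k.
        by apply/setIidr; have [] := hP k.
      rewrite sum_ord_const ?lee_fin ?ltW// muA -EFinM.
      have AUoo : mu (A `\` \bigcup_k Q k) < +oo.
        by apply: le_lt_trans Aoo; apply: le_mu => //; exact: measurableD.
      rewrite -(fineK (fin_num_measure_lt AUoo)) -EFinD => -[e].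
      by congr (_%:E); lra.
    have UA : \bigcup_k Q k `<=` A by move=> x [k _]; have [_ QA _ _ _] := hP k; exact: QA.
    exists (A `\` \bigcup_k Q k); split => //; first exact: measurableD.
    move=> x /= xN; apply: contrapT => xAU; apply: xN.
    have [Ux|Ux] := pselect ((\bigcup_k Q k) x); first by rewrite !putT//; exact: UA.
    by rewrite [leRHS]putN// putN// => Ax; apply: xAU.
  - by move=> k; have [] := hP k.
  - by move=> k x Pk; apply: le_trans (hf x); rewrite lee_fin; have [_ _ _ _] := hP k; apply.
have rA : rho (Defs.indic A) \is a fin_num.
  have [_ _ hA _ _] := fn; rewrite ge0_fin_numE ?hA//; exact: (rho_ge0 fn).
have rA0 : (0 <= fine (rho (Defs.indic A)))%R by rewrite fine_ge0// (rho_ge0 fn).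
apply/lee_addgt0Pr => e e0.
(* The added 1 avoids dividing by zero when the indicator of [A] has norm 0. *)
have k0 : (0 < fine (rho (Defs.indic A)) + 1)%R by rewrite ltr_wpDl.
apply: (le_trans (step (e / (fine (rho (Defs.indic A)) + 1))%R _)).
  by rewrite divr_gt0.
rewrite leeD2l// -(fineK rA) -EFinM lee_fin -mulrA ger_pMr//= mulrC.
by rewrite ler_pdivrMr// mul1r lerDl.
Qed.

End averaging.

(** * Conditional expectations over finite sigma-algebras *)

Lemma seq_minimal {T : Type} (s : seq (set T)) (p : set (set T)) :
  (exists2 Q, Q \in s & p Q) ->
  exists Q, [/\ Q \in s, p Q & forall B, B \in s -> p B -> B `<=` Q -> B = Q].
Proof.
elim: s => [[//]|A s IH] [Q0 Q0s pQ0].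
have [hs|hs] := pselect (exists2 Q, Q \in s & p Q); last first.
  have memA B : B \in A :: s -> p B -> B = A.
    by rewrite inE => /predU1P[//|Bs pB]; exfalso; apply: hs; exists B.
  exists A; split; first by rewrite inE eqxx.
    by rewrite -(memA _ Q0s pQ0).
  by move=> B Bs pB _; exact: memA.
have [Q [Qs pQ minQ]] := IH hs.
(* The head [A] replaces the minimal set [Q] of the tail only if it satisfies [p] and lies inside
   [Q]. *)
have [[pA AQ]|nA] := pselect (p A /\ A `<=` Q).
  exists A; split => //; first by rewrite inE eqxx.
  move=> B; rewrite inE => /predU1P[//|Bs pB BA].
  have BQ := minQ B Bs pB (subset_trans BA AQ).
  by apply/seteqP; split => //; rewrite BQ.
exists Q; split => //; first by rewrite inE Qs orbT.
move=> B; rewrite inE => /predU1P[-> pA AQ|]; last exact: minQ.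
by exfalso; apply: nA.
Qed.

Section finite_conditioning.
Context {d : measure_display} {T : measurableType d} {R : realType}.
Variable mu : {measure set T -> \bar R}.
Variables (S0 : set (set T)) (f g : T -> \bar R).
Hypotheses (fS0 : finite_sub_sigma_algebra S0) (Lf : L0p f).
Hypothesis gE : is_cond_exp mu S0 f g.

Lemma L0p_cond_exp : L0p g.
Proof.
have [mg g0 _] := gE; have [_ S0m _] := fS0; split => // _ Y mY.
by rewrite setTI; apply: S0m; exact: mg.
Qed.

Lemma level_S0 v : S0 (g @^-1` [set v]).
Proof. by have [mg _ _] := gE; apply: mg; exact: emeasurable_set1. Qed.

Lemma integral_level v : \int[mu]_(x in g @^-1` [set v]) f x = v * mu (g @^-1` [set v]).
Proof.
have [_ _ ->] := gE; last exact: level_S0.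
rewrite (eq_integral (cst v)); last by move=> x /set_mem /= ->.
by rewrite integral_cst//; have [_ + _] := fS0; apply; exact: level_S0.
Qed.

Lemma S0U A B : S0 A -> S0 B -> S0 (A `|` B).
Proof.
have [[S00 _ S0U] _ _] := fS0 => SA SB.
by rewrite -bigcup2E; apply: S0U => -[|[|n]].
Qed.

Lemma S0D A B : S0 A -> S0 B -> S0 (A `\` B).
Proof.
have [[_ S0C _] _ _] := fS0 => SA SB.
have -> : A `\` B = setT `\` ((setT `\` A) `|` B).
  by rewrite !setTD setCU setCK.
by apply: (S0C); apply: S0U => //; exact: S0C.
Qed.

Hypothesis uniq_g : forall h, is_cond_exp mu S0 f h -> {ae mu, forall x, h x = g x}.

(** On a minimal [S0]-set [Q] of infinite measure inside the level set, the value [v] may be changed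
    to another positive [w]: every [S0]-set either misses [Q] or contains it, and in the second case
    both integrals over [Q] are [+oo]. *)
Lemma level_lty v : 0 < v -> mu (g @^-1` [set v]) < +oo.
Proof.
move=> v0; rewrite ltey; apply/eqP => voo.
have [_ S0m /finite_seqP[s S0s]] := fS0.
have [|Q [Qs [Qv Qoo] minQ]] :=
    @seq_minimal T s (fun Q => Q `<=` g @^-1` [set v] /\ mu Q = +oo).
  exists (g @^-1` [set v]); last by split.
  by have := level_S0 v; rewrite S0s.
have SQ : S0 Q by rewrite S0s.
have mQ := S0m _ SQ.
have {}minQ B : S0 B -> mu B = +oo -> B `<=` Q -> B = Q.
  move=> SB Boo BQ; apply: minQ => //; first by move: SB; rewrite S0s.
  by split => //; exact: subset_trans BQ Qv.
pose w : \bar R := if v == 1 then 2%:E else 1.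
have w0 : 0 < w by rewrite /w; case: ifP => _; rewrite lte_fin.
have wv : w != v.
  by rewrite /w; case: ifPn => [/eqP ->|]; [rewrite eqe (_ : 1 = 1%:R)%R ?eqr_nat|rewrite eq_sym].
have [mg g0 intg] := gE.
have Lg := L0p_cond_exp.
have Lh : L0p (put Q w g) by apply: L0p_put => //; exact: ltW.
suff /uniq_g : is_cond_exp mu S0 f (put Q w g).
  (* The two functions differ at every point of [Q], so [Q] would be contained in a null set. *)
  move=> [N [mN N0 hN]].
  have : mu Q <= mu N.
    apply: le_mu => // x Qx; apply: hN => /=; rewrite putT// => wg.
    by have /= gv := Qv _ Qx; move: wv; rewrite wg gv eqxx.
  by rewrite N0 Qoo leye_eq.
split; [|exact: Lh.2|].
- move=> B mB; have SB := mg B mB.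
  have [wB|wB] := pselect (B w).
    have -> : put Q w g @^-1` B = (g @^-1` B `\` Q) `|` Q.
      apply/seteqP; split => x /=.
        by have [Qx|Qx] := pselect (Q x); [right|rewrite putN//; left].
      by move=> [[Bx Qx]|Qx]; [rewrite putN|rewrite putT].
    by apply: S0U => //; exact: S0D.
  have -> : put Q w g @^-1` B = g @^-1` B `\` Q.
    apply/seteqP; split => x /=.
      by have [Qx|Qx] := pselect (Q x); [rewrite putT|rewrite putN].
    by move=> [Bx Qx]; rewrite putN.
  exact: S0D.
- move=> A SA; have mA := S0m _ SA.
  (* By minimality of [Q], either [Q] without [A] is all of [Q], or it has finite measure and the
     part of [Q] in [A] is all of [Q]. *)
  have [AQoo|AQfin] := eqVneq (mu (Q `\` A)) +oo.
    have QA := minQ _ (S0D SQ SA) AQoo (@subDsetl _ _ _).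
    rewrite intg//; apply: eq_integral => x /set_mem Ax; rewrite putN//.
    by rewrite -QA => -[].
  have QA : Q `<=` A.
    have : Q `\` (Q `\` A) = Q.
      apply: minQ; [by apply: S0D => //; exact: S0D| |by move=> x []].
      have := measure_subD mu mQ (S0m _ (S0D SQ SA)) (@subDsetl _ _ _).
      rewrite Qoo; move: AQfin; case: (mu (Q `\` A)) (measure_ge0 mu (Q `\` A)) => //= r _ _.
      by case: (mu _) => //.
    by move=> <- x [Qx h]; apply: contrapT => Ax; apply: h.
  rewrite (ge0_integral_subD mu mA mQ QA Lf) (ge0_integral_subD mu mA mQ QA Lh).
  congr (_ + _).
    rewrite intg//.
    rewrite (eq_integral (cst v)); last by move=> x /set_mem /Qv.
    rewrite [RHS](eq_integral (cst w)); last by move=> x /set_mem Qx; rewrite putT.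
    by rewrite !integral_cst// Qoo !gt0_muley.
  rewrite intg; last exact: S0D.
  by apply: eq_integral => x /set_mem[_ Qx]; rewrite putN.
Qed.

Variable rho : (T -> \bar R) -> \bar R.
Hypotheses (res : resonant mu) (fn : function_norm mu rho).
Hypothesis ri : rearrangement_invariant mu rho.
Hypothesis fint : forall E, measurable E -> mu E < +oo -> \int[mu]_(x in E) f x < +oo.

(** The level sets of [g] listed in [l] are averaged one after the other. Keeping [f' = f] on the
    levels not yet treated ensures that the next average is the value of [g]; asking only for
    [g <= f'] almost everywhere lets levels of value 0 or measure 0 be skipped. *)
Lemma rho_average_levels (l : seq (set T)) :
  exists f', [/\ L0p f', rho f' <= rho f,
    (forall x, g @^-1` [set g x] \notin l -> f' x = f x) &
    {ae mu, forall x, g @^-1` [set g x] \in l -> g x <= f' x}].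
Proof.
have [mg g0 intg] := gE; have [_ S0m _] := fS0.
elim: l => [|B l [f' [Lf' rf' f'f gf']]].
  by exists f; split => //; exact: aeW.
have [Bl|Bl] := boolP (B \in l).
  exists f'; split => //.
    by move=> x; rewrite inE negb_or => /andP[_]; exact: f'f.
  by apply: filterS gf' => x h; rewrite inE => /predU1P[xB|//]; apply: h; rewrite xB.
have f'f' x : g @^-1` [set g x] \notin B :: l -> f' x = f x.
  by rewrite inE negb_or => /andP[_]; exact: f'f.
have [[x0 Bx0]|nB] := pselect (exists x, B = g @^-1` [set g x]); last first.
  exists f'; split => //.
  apply: filterS gf' => x h; rewrite inE => /predU1P[xB|//].
  by exfalso; apply: nB; exists x.
have gB x : g @^-1` [set g x] = B -> g x = g x0.
  by move=> xB; have : B x by [rewrite -xB]; rewrite Bx0.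
have mB : measurable B by rewrite Bx0; apply: S0m; exact: level_S0.
(* The level of value 0 may have infinite measure, but there [g <= f'] is trivial. *)
have [v0|v0] := eqVneq (g x0) 0.
  exists f'; split => //; apply: filterS gf' => x h; rewrite inE => /predU1P[xB|//].
  by rewrite (gB _ xB) v0 Lf'.2.
have {}v0 : 0 < g x0 by rewrite lt0e v0 g0.
have [B0|B0] := eqVneq (mu B) 0.
  have nB : {ae mu, forall x, ~ B x} by exists B; split => // x /= /contrapT.
  exists f'; split => //; apply: filterS2 gf' nB => x h nBx.
  by rewrite inE => /predU1P[xB|//]; exfalso; apply: nBx; rewrite -xB.
have Boo : mu B < +oo by rewrite Bx0; exact: level_lty.
have {}B0 : 0 < mu B by rewrite lt0e B0/=.
have intB : \int[mu]_(x in B) f x = g x0 * mu B by rewrite Bx0 integral_level.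
have f'B : \int[mu]_(x in B) f' x = g x0 * mu B.
  rewrite -intB; apply: eq_integral => x /set_mem Bx; apply: f'f.
  by move: (Bx); rewrite {1}Bx0 /= => ->; rewrite -Bx0.
(* An infinite value on a set of positive finite measure would make the integral of [f] over it
   infinite. *)
have voo : g x0 \is a fin_num.
  rewrite ge0_fin_numE// ltey; apply/eqP => voo.
  by have := fint mB Boo; rewrite intB voo gt0_mulye// ltxx.
rewrite -(fineK voo) in f'B.
exists (put B (g x0) f'); split.
- by apply: L0p_put => //; exact: ltW.
- rewrite (le_trans _ rf')// -(fineK voo).
  by apply: (rho_put_avg res fn ri mB B0 Boo Lf' _ f'B); exact: fine_ge0.
- move=> x xBl; rewrite putN ?f'f'// => Bx.
  move: (Bx) xBl; rewrite {1}Bx0 /= => ->; by rewrite -Bx0 inE eqxx.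
- apply: filterS gf' => x h; rewrite inE => xBl.
  have [Bx|Bx] := pselect (B x).
    by rewrite putT//; move: Bx; rewrite Bx0 /= => ->.
  rewrite putN//; move: xBl => /predU1P[xB|]; last exact: h.
  by exfalso; apply: Bx; rewrite -xB.
Qed.

End finite_conditioning.

(** * The leveling inequality, with constant 1 *)

Theorem theorem3p47 (d : measure_display) (T : measurableType d) (R : realType)
  (mu : {measure set T -> \bar R}) (rho : (T -> \bar R) -> \bar R) :
  sigma_finite setT mu ->
  resonant mu ->
  function_norm mu rho ->
  rearrangement_invariant mu rho ->
  (forall E : set T, measurable E -> mu E < +oo ->
     exists C_E : R, forall f, L0p f -> \int[mu]_(x in E) f x <= C_E%:E * rho f) ->
  leveling mu rho.
Proof.
move=> _ res fn ri emb; exists 1%R => S0 f g fS0 Lf gE uniq_g; rewrite mul1e.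
have [->|rfoo] := eqVneq (rho f) +oo; first exact: leey.
have rffin : rho f \is a fin_num by rewrite ge0_fin_numE ?(rho_ge0 fn)// ltey.
(* When [rho f] is finite, the local embedding into integrable functions makes [f] integrable over
   every set of finite measure, so its averages there are finite. *)
have fint E : measurable E -> mu E < +oo -> \int[mu]_(x in E) f x < +oo.
  move=> mE Eoo; have [C hC] := emb E mE Eoo.
  by apply: le_lt_trans (hC f Lf) _; rewrite -(fineK rffin) -EFinM ltry.
(* With [l] listing all of [S0], every level set of [g] is treated, so [g <= f'] almost
   everywhere. *)
have [_ _ /finite_seqP[l S0l]] := fS0.
have [f' [Lf' rf' _ gf']] := rho_average_levels fS0 Lf gE uniq_g res fn ri fint l.
apply: le_trans rf'; have [_ mono _ _ _] := fn; apply: mono => //.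
  exact: (L0p_cond_exp fS0 gE).
apply: filterS gf' => x; apply.
by have := level_S0 gE (g x); rewrite S0l.
Qed.
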